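(* Let $z^{\mathrm{SDP}}$ be the optimal value of $$\min_{Y\in\mathcal Y}\; Q^0\bullet Y\quad\text{s.t.}\quad Q^k\bullet Y\le 0,\ k=1,\dots,m,\qquad Y\in\mathcal S^+,$$ and let $z^{\mathrm{SDP\text{-}E}}$ be the optimal value of $$\min_{Y\in\mathcal Y}\; Q^0\bullet Y\quad\text{s.t.}\quad Q^k\bullet Y\le 0,\ k=1,\dots,m,\qquad C\bullet Y\ge 0\ \ \forall\, C\in\mathcal S^+\cap\mathcal S(E),\qquad Y_{ij}=0\ \ \forall (i,j)\notin E.$$ Then $z^{\mathrm{SDP}}=z^{\mathrm{SDP\text{-}E}}$.
   Context: All matrices are real symmetric of size $(n+1)\times(n+1)$ with rows and columns indexed by $0,1,\dots,n$. $\mathcal S$ is the space of such matrices, $\mathcal S^+\subset\mathcal S$ the cone of positive semidefinite ones, and $A\bullet B=\operatorname{tr}(B^\top A)$. Data: for $k=0,\dots,m$, a symmetric $n\times n$ matrix $\bar Q^k$ (not assumed positive semidefinite), $c_k\in\mathbb R^n$, $d_k\in\mathbb R$, and $Q^k=\begin{bmatrix} d_k & \tfrac12 c_k^\top\\ \tfrac12 c_k & \bar Q^k\end{bmatrix}\in\mathcal S$. A set $\mathcal X\subseteq\mathbb R^n$ encodes simple linear or bound constraints. The sparsity pattern is $$E=\{(i,j)\in\{0,\dots,n\}^2: i=0\text{ or }j=0\text{ or }i=j\text{ or }Q^k_{ij}\ne0\text{ for some }k\in\{0,\dots,m\}\},$$ and $\mathcal S(E)=\{Y\in\mathcal S: Y_{ij}=0\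 \forall (i,j)\notin E\}$. $\mathcal Y$ is the set of $Y\in\mathcal S$ with $Y_{00}=1$ and $(Y_{10},\dots,Y_{n0})^\top\in\mathcal X$. It may in addition include finitely many linear inequality constraints on $Y$ whose coefficient matrices lie in $\mathcal S(E)$ (any additional linear constraints are assumed supported on $E$). Optimal values are understood as infima in $[-\infty,+\infty]$. *)

(* Defs.v *)
(* The real line is an arbitrary R : realType.
   The index set {0, ..., n} is 'I_n.+1, and {0, ..., m} is 'I_m.+1; the
   indices 1, ..., n and 1, ..., m are lift ord0 i for i : 'I_n, 'I_m. *)
From HB Require Import structures.
From mathcomp Require Import all_boot all_order all_algebra.
From mathcomp Require Import all_classical all_reals all_analysis.

Set Implicit Arguments.
Unset Strict Implicit.
Unset Printing Implicit Defensive.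

Import Order.TTheory GRing.Theory Num.Theory.

Local Open Scope classical_set_scope.
Local Open Scope ring_scope.

Definition inner_mx (R : realType) (N : nat) (A B : 'M[R]_N) : R :=
  \tr (B^T *m A).

Definition psd_cone (R : realType) (N : nat) : set 'M[R]_N :=
  [set A | A \is symmetricmx /\
           forall x : 'cV[R]_N, 0 <= (x^T *m A *m x) 0 0].

(* The row/column carrying d is index 0, since 1 + n computes to n.+1. *)
Definition quad_mx (R : realType) (n : nat)
    (Qbar : 'M[R]_n) (c : 'cV[R]_n) (d : R) : 'M[R]_n.+1 :=
  block_mx (d%:M : 'M[R]_1) (2^-1 *: c^T) (2^-1 *: c) Qbar.

Definition sparsity (R : realType) (n m : nat) (Q : 'I_m.+1 -> 'M[R]_n.+1) :
    set ('I_n.+1 * 'I_n.+1) :=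
  [set ij | [\/ ij.1 = ord0, ij.2 = ord0, ij.1 = ij.2 |
                exists k, Q k ij.1 ij.2 != 0]].

Definition supported_sym (R : realType) (n : nat)
    (E : set ('I_n.+1 * 'I_n.+1)) : set 'M[R]_n.+1 :=
  [set Y | Y \is symmetricmx /\ forall i j, ~ E (i, j) -> Y i j = 0].

(* (L, b) are the additional linear inequalities L l . Y <= b l; there are
   none when p = 0. *)
Definition lifted_set (R : realType) (n p : nat) (X : set 'cV[R]_n)
    (L : 'I_p -> 'M[R]_n.+1) (b : 'I_p -> R) : set 'M[R]_n.+1 :=
  [set Y | [/\ Y \is symmetricmx,
               Y ord0 ord0 = 1,
               X (\col_i Y (lift ord0 i) ord0) &
               forall l, inner_mx (L l) Y <= b l]].

Definition sdp_feasible (R : realType) (n m : nat)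
    (Q : 'I_m.+1 -> 'M[R]_n.+1) (YY : set 'M[R]_n.+1) : set 'M[R]_n.+1 :=
  [set Y | [/\ YY Y,
               forall k : 'I_m, inner_mx (Q (lift ord0 k)) Y <= 0 &
               psd_cone Y]].

Definition sdpE_feasible (R : realType) (n m : nat)
    (Q : 'I_m.+1 -> 'M[R]_n.+1) (YY : set 'M[R]_n.+1) : set 'M[R]_n.+1 :=
  [set Y | [/\ YY Y,
               forall k : 'I_m, inner_mx (Q (lift ord0 k)) Y <= 0,
               forall C, (@psd_cone R n.+1 `&` supported_sym (sparsity Q)) C ->
                 0 <= inner_mx C Y &
               forall i j, ~ sparsity Q (i, j) -> Y i j = 0]].

(* The infimum in [-oo, +oo] (+oo if F is empty). *)
Definition optimal_value (R : realType) (n : nat)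
    (Q0 : 'M[R]_n.+1) (F : set 'M[R]_n.+1) : \bar R :=
  ereal_inf [set (inner_mx Q0 Y)%:E | Y in F].

(* Main.v *)
Require Import Defs.
From HB Require Import structures.
From mathcomp Require Import all_boot all_order all_algebra.
From mathcomp Require Import all_classical all_reals all_analysis.
From mathcomp Require Import ring lra.

Set Implicit Arguments.
Unset Strict Implicit.
Unset Printing Implicit Defensive.

Import Order.TTheory GRing.Theory Num.Theory.
Import numFieldNormedType.Exports.

Local Open Scope classical_set_scope.
Local Open Scope ring_scope.

(** Write pi_E for the map that zeroes the entries outside the pattern E.
    Every functional occurring in either problem (objective, quadratic
    constraints, extra linear constraints, the entries Y_00 and Y_i0) only
    reads entries in E, so it takes the same value at Y and at pi_E Y.  It
    thus suffices to show that pi_E sends the feasible set of the SDP onto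
    that of the sparse problem; the two sets of objective values are then
    equal, and so are their infima.

    - pi_E maps into the sparse feasible set: for C positive semidefinite and
      supported on E, C . (pi_E Y) = C . Y, which is nonnegative because the
      inner product of two positive semidefinite matrices is ([psd_inner_ge0],
      by peeling rank-one terms off one of them).
    - pi_E is onto ([psd_completion]): a matrix Y supported on E that pairs
      nonnegatively with every positive semidefinite C supported on E agrees
      on E with a positive semidefinite M.  This is conic duality: the dual of
      the intersection of the semidefinite cone with the matrices supported on
      E is the closure of the image of the semidefinite cone under pi_E.  The
      image is already closed because E contains the diagonal, and a positive
      semidefinite matrix is controlled by its diagonal.  Concretely, take M
      minimizing the distance from pi_E M to Y ([psd_mask_nearest]) and put
      C = pi_E M - Y.  First-order optimality in the directions x x^T says
      that C is positive semidefinite, and in the direction -M that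
      C . M <= 0; hence 0 <= C . Y = C . M - C . C <= - C . C, so C = 0. *)

(** * The trace inner product *)

Lemma inner_mxE (R : realType) N (A B : 'M[R]_N) :
  inner_mx A B = \sum_i \sum_j A i j * B i j.
Proof.
rewrite /inner_mx /mxtrace exchange_big; apply: eq_bigr => j _.
by rewrite mxE; apply: eq_bigr => i _; rewrite mxE mulrC.
Qed.

Lemma inner_mxC (R : realType) N (A B : 'M[R]_N) : inner_mx A B = inner_mx B A.
Proof. by rewrite /inner_mx -mxtrace_tr trmx_mul trmxK. Qed.

Lemma inner_mxDr (R : realType) N (A B C : 'M[R]_N) :
  inner_mx A (B + C) = inner_mx A B + inner_mx A C.
Proof. by rewrite /inner_mx linearD mulmxDl linearD. Qed.

Lemma inner_mx0r (R : realType) N (A : 'M[R]_N) : inner_mx A 0 = 0.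
Proof. by rewrite /inner_mx trmx0 mul0mx mxtrace0. Qed.

Lemma inner_mxZr (R : realType) N a (A B : 'M[R]_N) :
  inner_mx A (a *: B) = a * inner_mx A B.
Proof. by rewrite /inner_mx linearZ -scalemxAl linearZ. Qed.

Lemma inner_mx_line (R : realType) N t (A B : 'M[R]_N) :
  inner_mx (A + t *: B) (A + t *: B) =
  inner_mx A A + t * (inner_mx A B *+ 2 + t * inner_mx B B).
Proof.
rewrite inner_mxDr inner_mxZr ![inner_mx (A + _) _]inner_mxC.
rewrite !inner_mxDr !inner_mxZr (inner_mxC B A); ring.
Qed.

(** Quadratic forms are pairings with rank-one matrices; this is what turns
    positive semidefiniteness into a family of linear conditions. *)
Lemma quad_form_inner (R : realType) N (A : 'M[R]_N) (x : 'cV[R]_N) :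
  (x^T *m A *m x) 0 0 = inner_mx A (x *m x^T).
Proof.
rewrite /inner_mx trmx_mul trmxK -[in RHS]mulmxA mxtrace_mulC.
by rewrite [in RHS]trace_mx11.
Qed.

Lemma sqr_entry_le_inner (R : realType) N (A : 'M[R]_N) i j :
  A i j ^+ 2 <= inner_mx A A.
Proof.
rewrite inner_mxE (bigD1 i) //= (bigD1 j) //= -expr2 -addrA lerDl addr_ge0 //.
  by apply: sumr_ge0 => k _; exact: sqr_ge0.
by apply: sumr_ge0 => k _; apply: sumr_ge0 => l _; exact: sqr_ge0.
Qed.

Lemma inner_mx_ge0 (R : realType) N (A : 'M[R]_N) : 0 <= inner_mx A A.
Proof.
rewrite inner_mxE; apply: sumr_ge0 => i _; apply: sumr_ge0 => j _.
exact: sqr_ge0.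
Qed.

Lemma inner_mx_eq0 (R : realType) N (A : 'M[R]_N) : inner_mx A A <= 0 -> A = 0.
Proof.
move=> A0; apply/matrixP => i j; rewrite mxE; apply/eqP.
by rewrite -sqrf_eq0 eq_le sqr_ge0 (le_trans (sqr_entry_le_inner A i j)).
Qed.

(** * Positive semidefinite matrices *)

Lemma symmetricmx_entry (R : realType) N (A : 'M[R]_N) :
  A \is symmetricmx <-> forall i j, A i j = A j i.
Proof.
split=> [/is_hermitianmxP As i j|As].
  by rewrite {1}As expr0 scale1r !mxE.
by apply/is_hermitianmxP/matrixP => i j; rewrite expr0 scale1r !mxE.
Qed.

Lemma symmetricmx_line (R : realType) N a (A B : 'M[R]_N) :
  A \is symmetricmx -> B \is symmetricmx -> A + a *: B \is symmetricmx.
Proof.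
move=> /symmetricmx_entry As /symmetricmx_entry Bs.
by apply/symmetricmx_entry => i j; rewrite !mxE As Bs.
Qed.

Lemma psd_cone0 (R : realType) N : psd_cone (0 : 'M[R]_N).
Proof.
split=> [|x]; first by apply/symmetricmx_entry => i j; rewrite !mxE.
by rewrite mulmx0 mul0mx mxE.
Qed.

Lemma psd_coneD (R : realType) N (A B : 'M[R]_N) :
  psd_cone A -> psd_cone B -> psd_cone (A + B).
Proof.
move=> [/symmetricmx_entry As Ap] [/symmetricmx_entry Bs Bp]; split=> [|x].
  by apply/symmetricmx_entry => i j; rewrite !mxE As Bs.
by rewrite mulmxDr mulmxDl mxE addr_ge0.
Qed.

Lemma psd_coneZ (R : realType) N a (A : 'M[R]_N) :
  0 <= a -> psd_cone A -> psd_cone (a *: A).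
Proof.
move=> a0 [/symmetricmx_entry As Ap]; split=> [|x].
  by apply/symmetricmx_entry => i j; rewrite !mxE As.
by rewrite -scalemxAr -scalemxAl mxE mulr_ge0.
Qed.

Lemma quad_form_rank1 (R : realType) N (x y : 'cV[R]_N) :
  (y^T *m (x *m x^T) *m y) 0 0 = (y^T *m x) 0 0 ^+ 2.
Proof.
rewrite mulmxA -mulmxA -[x^T *m y]trmxK trmx_mul trmxK mxE big_ord1.
by rewrite [X in _ * X]mxE.
Qed.

Lemma psd_cone_rank1 (R : realType) N (x : 'cV[R]_N) : psd_cone (x *m x^T).
Proof.
split=> [|y].
  apply/symmetricmx_entry => i j; rewrite !mxE.
  by apply: eq_bigr => k _; rewrite !mxE mulrC.
by rewrite quad_form_rank1 sqr_ge0.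
Qed.

Lemma quad_form_line (R : realType) N (A : 'M[R]_N) (x y : 'cV[R]_N) s :
  A \is symmetricmx ->
  ((x + s *: y)^T *m A *m (x + s *: y)) 0 0 =
  (x^T *m A *m x) 0 0 + s * (x^T *m A *m y) 0 0 *+ 2
    + s ^+ 2 * (y^T *m A *m y) 0 0.
Proof.
move=> /symmetricmx_entry As.
have At : A^T = A by apply/matrixP => i j; rewrite mxE As.
have yAx : y^T *m A *m x = (x^T *m A *m y)^T.
  by rewrite !trmx_mul trmxK At mulmxA.
have -> : (x + s *: y)^T = x^T + s *: y^T by rewrite linearD linearZ.
rewrite !mulmxDl !mulmxDr -!scalemxAl -!scalemxAr yAx.
set a := x^T *m A *m x; set b := x^T *m A *m y; set c := y^T *m A *m y.
by rewrite !mxE; ring.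
Qed.

(** Evaluate the form at e_i + e_j and e_i - e_j.  The diagonal thus bounds a
    positive semidefinite matrix, which is the source of compactness below. *)
Lemma psd_entry_le (R : realType) N (A : 'M[R]_N) i j :
  psd_cone A -> `|A i j| *+ 2 <= A i i + A j j.
Proof.
move=> [As Ap].
have key (s : R) : 0 <= A i i + s * A i j *+ 2 + s ^+ 2 * A j j.
  have := Ap (delta_mx i 0 + s *: delta_mx j 0).
  by rewrite quad_form_line // !trmx_delta -!rowE -!colE !mxE.
have := key 1; have := key (-1).
by case: (ger0P (A i j)) => _; lra.
Qed.

(** With a = y^T A y > 0 and b = x^T A y, the new form at x is x^T A x - b^2 / a,
    the minimum over s of the old form at x + s y.  When a = 0, nothing is
    subtracted, since the inverse of 0 is 0. *)
Lemma psd_deflate (R : realType) N (A : 'M[R]_N) (y : 'cV[R]_N) :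
  psd_cone A ->
  psd_cone (A - ((y^T *m A *m y) 0 0)^-1 *: (A *m y *m (A *m y)^T)).
Proof.
move=> [As Ap]; set al := (y^T *m A *m y) 0 0; split=> [|x].
  rewrite -scaleNr; apply: symmetricmx_line => //.
  by case: (psd_cone_rank1 (A *m y)).
set be := (x^T *m A *m y) 0 0.
suff -> : (x^T *m (A - al^-1 *: (A *m y *m (A *m y)^T)) *m x) 0 0 =
  (x^T *m A *m x) 0 0 - al^-1 * be ^+ 2.
  have [al0|al0] := eqVneq al 0; first by rewrite al0 invr0 mul0r subr0.
  have := Ap (x + (- (al^-1 * be)) *: y).
  rewrite quad_form_line // -/al -/be; congr (_ <= _); field.
  by [].
rewrite mulmxBr mulmxBl -scalemxAr -scalemxAl [LHS]mxE [X in _ + X]mxE.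
by rewrite [X in - X]mxE quad_form_rank1 mulmxA.
Qed.

(** Deflating A along e_i when A_ii is nonzero subtracts the rank-one matrix
    a a^T / A_ii, with a the column i of A, whose pairing with C is
    nonnegative.  It annihilates the diagonal entry i and keeps the vanishing
    diagonal entries zero, so induction on the number of nonzero diagonal
    entries applies; when there are none, A = 0. *)
Lemma psd_inner_ge0 (R : realType) N (C A : 'M[R]_N) :
  psd_cone C -> psd_cone A -> 0 <= inner_mx C A.
Proof.
move=> Cp; have [k] := ubnP #|[pred i | A i i != 0]|.
elim: k A => // k IH A Ak Ap.
have [i Ai|A0] := pickP (fun i => A i i != 0); last first.
  suff -> : A = 0 by rewrite inner_mx0r.
  apply/matrixP => i j; have := psd_entry_le i j Ap.
  move: (A0 i) (A0 j) => /negbFE/eqP -> /negbFE/eqP ->.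
  by rewrite addr0 mxE pmulrn_lle0 // normr_le0 => /eqP.
have diag_ge0 (B : 'M[R]_N) j : psd_cone B -> 0 <= B j j.
  move=> Bp; have := psd_entry_le j j Bp.
  by rewrite -mulr2n lerMn2r /=; apply: le_trans.
pose D := A - (A i i)^-1 *: (col i A *m (col i A)^T).
have Dp : psd_cone D.
  have := psd_deflate (delta_mx i 0) Ap.
  by rewrite trmx_delta -rowE -!colE !mxE.
have DE j : D j j = A j j - (A i i)^-1 * A j i ^+ 2.
  by rewrite !mxE big_ord1 !mxE.
have -> : A = D + (A i i)^-1 *: (col i A *m (col i A)^T) by rewrite subrK.
rewrite inner_mxDr inner_mxZr addr_ge0 //; last first.
  rewrite mulr_ge0 ?invr_ge0 ?diag_ge0 //.
  by rewrite -quad_form_inner; exact: Cp.2.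
apply: IH => //; move: Ak; rewrite ltnS; apply: leq_trans.
apply/proper_card/properP; split.
  apply/fintype.subsetP => j; rewrite !inE; apply: contraNneq => Aj.
  rewrite eq_le diag_ge0 // DE Aj sub0r oppr_le0.
  by rewrite mulr_ge0 ?sqr_ge0 // invr_ge0 diag_ge0.
by exists i; rewrite inE //= negbK DE expr2 mulrA mulVf // mul1r subrr.
Qed.

(** * Projection onto a sparsity pattern *)

Section Mask.
Variables (R : realType) (N : nat) (E : set ('I_N * 'I_N)).
Implicit Types A B : 'M[R]_N.

Definition mask (A : 'M[R]_N) : 'M[R]_N :=
  \matrix_(i, j) if `[< E (i, j) >] then A i j else 0.

Lemma mask_in A i j : E (i, j) -> mask A i j = A i j.
Proof. by move=> Eij; rewrite mxE asboolT. Qed.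

Lemma mask_out A i j : ~ E (i, j) -> mask A i j = 0.
Proof. by move=> Eij; rewrite mxE asboolF. Qed.

Lemma maskD A B : mask (A + B) = mask A + mask B.
Proof. by apply/matrixP => i j; rewrite !mxE; case: ifP; rewrite ?addr0. Qed.

Lemma maskZ a A : mask (a *: A) = a *: mask A.
Proof. by apply/matrixP => i j; rewrite !mxE; case: ifP; rewrite ?mulr0. Qed.

Lemma inner_mask A B :
  (forall i j, ~ E (i, j) -> A i j = 0) -> inner_mx A (mask B) = inner_mx A B.
Proof.
move=> A0; rewrite !inner_mxE; apply: eq_bigr => i _; apply: eq_bigr => j _.
have [Eij|Eij] := pselect (E (i, j)); first by rewrite mask_in.
by rewrite A0 // !mul0r.
Qed.

Lemma mask_sym A : (forall i j, E (i, j) -> E (j, i)) ->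
  A \is symmetricmx -> mask A \is symmetricmx.
Proof.
move=> Es /symmetricmx_entry As; apply/symmetricmx_entry => i j.
have [Eij|Eij] := pselect (E (i, j)); first by rewrite !mask_in //; exact: Es.
by rewrite !mask_out // => /Es.
Qed.

End Mask.

(** * Compactness and nearest points *)

(** A box of matrices is the image of a box of row vectors under the
    continuous reshaping [vec_mx]. *)
Lemma mx_compact (R : realType) m n (A : 'I_m -> 'I_n -> set R) :
  (forall i j, compact (A i j)) ->
  compact [set M : 'M[R]_(m, n) | forall i j, A i j (M i j)].
Proof.
move=> Ac.
have [u uK] : exists u : 'I_(m * n) -> 'I_m * 'I_n,
    forall i j, u (mxvec_index i j) = (i, j).
  have [u uK _] := curry_mxvec_bij m n.
  by exists u => i j; exact: (uK (i, j)).
pose B := [set v : 'rV[R]_(m * n) |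
  forall k, A (u k).1 (u k).2 (v ord0 k)].
have Bc : compact B by apply: (@rV_compact _ _ (fun k => A _ _)).
have vc : continuous (@vec_mx R m n).
  move=> v W [P vP PW].
  exists (fun _ k => P (u k).1 (u k).2).
    move=> i k; rewrite ord1.
    by case/mxvec_indexP: k => a b; have := vP a b; rewrite mxE uK.
  move=> w Pw; apply: PW => i j.
  by have := Pw ord0 (mxvec_index i j); rewrite mxE uK.
rewrite (_ : mkset _ = @vec_mx R m n @` B).
  by apply: continuous_compact => //; exact: continuous_subspaceT.
apply/seteqP; split=> [M AM|_ [v Bv <-] i j].
  exists (mxvec M); last exact: mxvecK.
  by move=> k; case/mxvec_indexP: k => i j; rewrite mxvecE uK.
by have := Bv (mxvec_index i j); rewrite uK mxE.
Qed.

Lemma continuous_subr (R : realType) (T : topologicalType) (f g : T -> R) :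
  continuous f -> continuous g -> continuous (fun x => f x - g x).
Proof. by move=> fc gc x; apply: cvgB; [exact: fc|exact: gc]. Qed.

Lemma inner_mx_continuous (R : realType) (T : topologicalType) N
    (F G : T -> 'M[R]_N) :
  (forall i j, continuous (fun x => F x i j)) ->
  (forall i j, continuous (fun x => G x i j)) ->
  continuous (fun x => inner_mx (F x) (G x)).
Proof.
move=> Fc Gc.
have -> : (fun x => inner_mx (F x) (G x)) =
    fun x => \sum_i \sum_j F x i j * G x i j.
  by apply/funext => x; rewrite inner_mxE.
apply: continuous_big => [|i _]; first exact: add_continuous.
apply: continuous_big => [|j _]; first exact: add_continuous.
by move=> x; apply: cvgM; [exact: Fc|exact: Gc].
Qed.

(** The cone is cut out by the closed conditions A_ij - A_ji = 0 and
    A . x x^T >= 0. *)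
Lemma psd_cone_closed (R : realType) N : closed (@psd_cone R N).
Proof.
have -> : @psd_cone R N =
    \bigcap_(ij in [set: 'I_N * 'I_N])
      [set A : 'M[R]_N | A ij.1 ij.2 - A ij.2 ij.1 = 0] `&`
    \bigcap_(x in [set: 'cV[R]_N])
      [set A : 'M[R]_N | 0 <= inner_mx A (x *m x^T)].
  apply/seteqP; split=> A [As Ap]; split.
  - by move=> ij _ /=; move/symmetricmx_entry: As => ->; rewrite subrr.
  - by move=> x _ /=; rewrite -quad_form_inner.
  - apply/symmetricmx_entry => i j; apply/subr0_eq.
    exact: (As (i, j) I).
  - by move=> x; rewrite quad_form_inner; exact: Ap.
apply: closedI; [apply: closed_bigI => ij _|apply: closed_bigI => x _].
  have c : continuous (fun A : 'M[R]_N => A ij.1 ij.2 - A ij.2 ij.1).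
    by apply: continuous_subr; exact: coord_continuous.
  exact: preimage_closed (fun A _ => c A) (@closed_eq _ 0).
have c : continuous (fun A : 'M[R]_N => inner_mx A (x *m x^T)).
  apply: inner_mx_continuous => i j; first exact: coord_continuous.
  exact: cst_continuous.
exact: preimage_closed (fun A _ => c A) (@closed_ge _ 0).
Qed.

(** The competitors at least as good as 0 have a diagonal bounded in terms of
    Y, because the diagonal lies in E and so contributes to the distance;
    being positive semidefinite, they lie in a compact box, where the
    continuous distance attains its minimum. *)
Lemma psd_mask_nearest (R : realType) N (E : set ('I_N * 'I_N)) (Y : 'M[R]_N) :
  (forall i, E (i, i)) ->
  exists2 M, psd_cone M & forall D, psd_cone D ->
    inner_mx (mask E M - Y) (mask E M - Y) <=
    inner_mx (mask E D - Y) (mask E D - Y).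
Proof.
move=> Ed; pose f M := inner_mx (mask E M - Y) (mask E M - Y).
have f0 : f 0 = inner_mx Y Y.
  rewrite /f.
  have -> : mask E 0 = 0 :> 'M[R]_N.
    by apply/matrixP => i j; rewrite !mxE; case: ifP.
  by rewrite sub0r -scaleN1r inner_mxZr inner_mxC inner_mxZr; ring.
(* (M_kk - Y_kk)^2 and Y_kk^2 are both at most Y . Y, and t <= 1 + t^2. *)
pose B : R := 2 * (1 + inner_mx Y Y).
pose K := [set M : 'M[R]_N | forall i j, M i j \in `[- B, B]] `&` @psd_cone R N.
have sub_K M : psd_cone M -> f M <= f 0 -> K M.
  move=> Mp fM; split=> // i j; rewrite in_itv /= -ler_norml.
  have diag k : M k k <= B.
    have le_sqr (t : R) : t <= 1 + t ^+ 2 by nra.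
    have := sqr_entry_le_inner (mask E M - Y) k k.
    rewrite -/(f M) [X in X ^+ 2]mxE [X in _ + X]mxE mask_in // => fk.
    have := sqr_entry_le_inner Y k k.
    have := le_sqr (M k k - Y k k); have := le_sqr (Y k k).
    by move: fM; rewrite f0 /B; lra.
  by have := psd_entry_le i j Mp; have := diag i; have := diag j; lra.
have K0 : K 0 by apply: sub_K => //; exact: psd_cone0.
have Kc : compact K.
  apply: compact_closedI; last exact: psd_cone_closed.
  apply: (@mx_compact _ _ _ (fun _ _ => `[- B, B]%classic)) => _ _.
  exact: segment_compact.
have fc : continuous f.
  have ec i j : continuous (fun M : 'M[R]_N => (mask E M - Y) i j).
    rewrite (_ : (fun M => _) = fun M => mask E M i j - Y i j); last first.
      by apply/funext => M; rewrite [LHS]mxE [X in _ + X]mxE.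
    apply: continuous_subr; last exact: cst_continuous.
    have [Eij|Eij] := pselect (E (i, j)).
      rewrite (_ : (fun M => _) = fun M : 'M[R]_N => M i j).
        exact: coord_continuous.
      by apply/funext => M; rewrite mask_in.
    rewrite (_ : (fun M => _) = fun=> 0); first exact: cst_continuous.
    by apply/funext => M; rewrite mask_out.
  exact: inner_mx_continuous.
have [M /set_mem[_ Mp] Mmin] :=
  compact_EVT_min (ex_intro _ 0 K0) Kc (continuous_subspaceT fc).
exists M => // D Dp; have [fD|/ltW fD] := leP (f D) (f 0).
  by apply: Mmin; apply: mem_set; exact: sub_K.
by apply: le_trans fD; apply: Mmin; exact: mem_set.
Qed.

(** * Duality for positive semidefinite completions *)

(** The right derivative at 0 of the parabola 2 a t + b t^2 is nonnegative if
    the parabola stays above its value at 0. *)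
Lemma right_slope_ge0 (R : realType) (a b : R) :
  (forall t, 0 < t <= 1 -> 0 <= t * (a *+ 2 + t * b)) -> 0 <= b -> 0 <= a.
Proof.
move=> h b0; rewrite leNgt; apply/negP => a0.
(* At t = - a / (b - a) the factor 2 a + t b is at most a < 0. *)
have ba0 : 0 < b - a by lra.
have t0 : 0 < - a / (b - a) by rewrite divr_gt0 ?oppr_gt0.
have /h : 0 < - a / (b - a) <= 1 by rewrite t0 ler_pdivrMr //; lra.
rewrite pmulr_rge0 // => h1.
have : - a / (b - a) * b <= - a.
  rewrite mulrAC ler_pdivrMr // ler_pM2l ?oppr_gt0 //; lra.
lra.
Qed.

(** The projection of the semidefinite cone onto E is the dual of the
    semidefinite matrices supported on E.  The residual C between Y and its
    nearest point in that projection is itself a test matrix, and testing Y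
    against it forces C = 0. *)
Lemma psd_completion (R : realType) n (E : set ('I_n.+1 * 'I_n.+1))
    (Y : 'M[R]_n.+1) :
  (forall i, E (i, i)) -> (forall i j, E (i, j) -> E (j, i)) ->
  supported_sym E Y ->
  (forall C, (@psd_cone R n.+1 `&` supported_sym E) C -> 0 <= inner_mx C Y) ->
  exists2 M, psd_cone M & mask E M = Y.
Proof.
move=> Ed Es [Ys Y0] Ypos.
have [M Mp Mmin] := psd_mask_nearest Y Ed.
exists M => //; set C := mask E M - Y in Mmin.
have C0 i j : ~ E (i, j) -> C i j = 0.
  by move=> Eij; rewrite /C !mxE asboolF // Y0 // subrr.
have Csym : C \is symmetricmx.
  rewrite /C -scaleN1r; apply: symmetricmx_line => //.
  by case: Mp => /(mask_sym Es).
(* Moving M along D cannot decrease the distance. *)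
have slope D : (forall t, 0 < t <= 1 -> psd_cone (M + t *: D)) ->
    0 <= inner_mx C D.
  move=> Dp; rewrite -(inner_mask D C0).
  apply: right_slope_ge0 (inner_mx_ge0 (mask E D)) => t t01.
  have := Mmin _ (Dp t t01).
  by rewrite maskD maskZ addrAC inner_mx_line lerDl.
(* M - t M stays in the cone for t <= 1. *)
have CM : 0 <= - inner_mx C M.
  rewrite -mulN1r -inner_mxZr; apply: slope => t /andP[_ t1].
  rewrite scalerA mulrN1 -[M in M + _]scale1r -scalerDl.
  by apply: psd_coneZ => //; rewrite subr_ge0.
have Cp : psd_cone C.
  split=> // x; rewrite quad_form_inner; apply: slope => t /andP[/ltW t0 _].
  by apply: psd_coneD => //; apply: psd_coneZ => //; exact: psd_cone_rank1.
have CY := Ypos C (conj Cp (conj Csym C0)).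
apply/subr0_eq/inner_mx_eq0; rewrite -/C.
have : inner_mx C C = inner_mx C M - inner_mx C Y.
  rewrite -[X in inner_mx C X]/(mask E M - Y) inner_mxDr inner_mask //.
  by rewrite -scaleN1r inner_mxZr mulN1r.
lra.
Qed.

(** * Equivalence of the two problems *)

Lemma quad_mx_sym (R : realType) n (Qbar : 'M[R]_n) c d :
  Qbar \is symmetricmx -> quad_mx Qbar c d \is symmetricmx.
Proof.
move=> /is_hermitianmxP; rewrite expr0 scale1r map_mx_id // => Qs.
apply/is_hermitianmxP; rewrite expr0 scale1r map_mx_id // /quad_mx.
have := tr_block_mx (d%:M : 'M[R]_1) (2^-1 *: c^T) (2^-1 *: c) Qbar.
by rewrite tr_scalar_mx !linearZ /= trmxK -Qs => /esym.
Qed.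

Lemma sparsity_sym (R : realType) n m (Q : 'I_m.+1 -> 'M[R]_n.+1) :
  (forall k, Q k \is symmetricmx) ->
  forall i j, sparsity Q (i, j) -> sparsity Q (j, i).
Proof.
move=> Qs i j [] /= h; [by apply: Or42|by apply: Or41|by apply: Or43|].
case: h => k; have /symmetricmx_entry -> := Qs k.
by move=> h; apply: Or44; exists k.
Qed.

Lemma sparsity_data (R : realType) n m (Q : 'I_m.+1 -> 'M[R]_n.+1) k i j :
  ~ sparsity Q (i, j) -> Q k i j = 0.
Proof.
move=> h; apply/eqP; apply: contra_notT h => Qkij.
by apply: Or44; exists k.
Qed.

(** Column 0 and the matrices L l lie in E, so all the constraints are read off
    the entries in E. *)
Lemma lifted_set_mask (R : realType) n p (X : set 'cV[R]_n)
    (L : 'I_p -> 'M[R]_n.+1) (b : 'I_p -> R) (E : set ('I_n.+1 * 'I_n.+1))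
    (A : 'M[R]_n.+1) :
  (forall i, E (i, ord0)) -> (forall i j, E (i, j) -> E (j, i)) ->
  (forall l, supported_sym E (L l)) -> A \is symmetricmx ->
  lifted_set X L b (mask E A) <-> lifted_set X L b A.
Proof.
move=> E0 Es LE As.
have colE : \col_i mask E A (lift ord0 i) ord0 = \col_i A (lift ord0 i) ord0.
  by apply/colP => i; rewrite [LHS]mxE [RHS]mxE mask_in.
have innerE l : inner_mx (L l) (mask E A) = inner_mx (L l) A.
  by apply: inner_mask; case: (LE l).
rewrite /lifted_set /= colE mask_in //.
split=> -[_ A00 XA LA]; split=> //.
- by move=> l; rewrite -innerE.
- exact: mask_sym.
- by move=> l; rewrite innerE.
Qed.

Theorem corollary2 (R : realType) (n m p : nat)
    (Qbar : 'I_m.+1 -> 'M[R]_n) (c : 'I_m.+1 -> 'cV[R]_n) (d : 'I_m.+1 -> R)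
    (Qbar_sym : forall k, Qbar k \is symmetricmx)
    (X : set 'cV[R]_n)
    (L : 'I_p -> 'M[R]_n.+1) (b : 'I_p -> R) :
  let Q := fun k => quad_mx (Qbar k) (c k) (d k) in
  (forall l, supported_sym (sparsity Q) (L l)) ->
  let YY := lifted_set X L b in
  let zSDP := optimal_value (Q ord0) (sdp_feasible Q YY) in
  let zSDPE := optimal_value (Q ord0) (sdpE_feasible Q YY) in
  zSDP = zSDPE.
Proof.
move=> Q LE YY zSDP zSDPE; set E := sparsity Q in LE.
have Es : forall i j, E (i, j) -> E (j, i).
  by apply: sparsity_sym => k; exact: quad_mx_sym.
have Ed i : E (i, i) by apply: Or43.
have E0 i : E (i, ord0) by apply: Or42.
have QE k A : inner_mx (Q k) (mask E A) = inner_mx (Q k) A.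
  by apply: inner_mask => i j; exact: sparsity_data.
have YYE A : A \is symmetricmx -> YY (mask E A) <-> YY A.
  exact: lifted_set_mask.
rewrite /zSDP /zSDPE /optimal_value; congr (ereal_inf _).
apply/seteqP; split=> [_ [Y [YYY QY Yp] <-]|_ [Y [YYY QY CY Y0] <-]].
  exists (mask E Y); last by rewrite QE.
  split=> [|k|C [Cp [_ C0]]|i j]; [|by rewrite QE| |exact: mask_out].
    by apply/YYE => //; case: Yp.
  by rewrite inner_mask //; exact: psd_inner_ge0.
have [Ysym _ _ _] := YYY.
have [M Mp MY] := psd_completion Ed Es (conj Ysym Y0) CY.
exists M; last by rewrite -QE MY.
split=> // [|k]; last by rewrite -QE MY.
by apply/YYE; [case: Mp|rewrite MY].
Qed.
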